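(* Let $\mathbf w(\mathcal D)$ and $\mathbf w(\mathcal D')$ be the IPW weights with estimated regression parameter for datasets $\mathcal D$ and $\mathcal D'$ of size $n$ that differ at one point. Suppose that every covariate vector (in $\mathcal D$ and $\mathcal D'$) satisfies $\|\mathbf x_i\|_2\le M$, that the regression coefficients are constrained to $\|\boldsymbol\lambda\|_2\le R_{\mathrm{IPW}}$, and that the sample covariance matrix $\hat\Sigma:=n^{-1}\sum_{i=1}^n\mathbf x_i\mathbf x_i^\top$ of $\mathcal D$ satisfies $\lambda_{\min}(\hat\Sigma)>0$. Define $$\rho:=\frac{\exp(-MR_{\mathrm{IPW}})}{(1+\exp(-MR_{\mathrm{IPW}}))^2}\,\lambda_{\min}(\hat\Sigma)+\lambda_{\mathrm{IPW}},\qquad\delta_I:=R_{\mathrm{IPW}}\wedge\frac{M/2}{\rho}.$$ Then $$\|\mathbf w(\mathcal D)-\mathbf w(\mathcal D')\|_2\le\frac{4M^2\exp(MR_{\mathrm{IPW}})}{\rho}+2M\delta_I\exp(M\delta_I)\left(1+\frac{1+\exp(M\delta_I)}{2n}\right).$$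
   Context: $a\wedge b=\min\{a,b\}$; $\lambda_{\min}$ is the smallest eigenvalue. A dataset is $\mathcal D=(\mathbf x_i,a_i)_{i=1}^n$ with $\mathbf x_i\in\mathbb R^p$ and $a_i\in\{0,1\}$. The estimated parameter is $$\hat{\boldsymbol\lambda}=\hat{\boldsymbol\lambda}(\mathcal D)=\arg\min_{\|\boldsymbol\lambda\|_2\le R_{\mathrm{IPW}}}\left[\frac1n\sum_{i=1}^n\Big(\log\big(1+\exp(\langle\mathbf x_i,\boldsymbol\lambda\rangle)\big)-a_i\langle\mathbf x_i,\boldsymbol\lambda\rangle\Big)+\frac{\lambda_{\mathrm{IPW}}}2\|\boldsymbol\lambda\|_2^2\right],$$ with a fixed coefficient $\lambda_{\mathrm{IPW}}\ge0$, and the weights are $$w_i(\mathcal D)=n\,\frac{1+\exp(-(2a_i-1)\langle\mathbf x_i,\hat{\boldsymbol\lambda}\rangle)}{\sum_{j=1}^n\big(1+\exp(-(2a_j-1)\langle\mathbf x_j,\hat{\boldsymbol\lambda}\rangle)\big)},\qquad i=1,\dots,n.$$ $\mathbf w(\mathcal D')$ is defined in the same way from $\mathcal D'$. *)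

(* Defs.v *)
From mathcomp Require Import all_boot all_order all_algebra.
From mathcomp Require Import all_classical all_reals all_analysis.

Set Implicit Arguments.
Unset Strict Implicit.
Unset Printing Implicit Defensive.

Import Order.TTheory GRing.Theory Num.Theory.
Local Open Scope ring_scope.

Definition inner (R : realType) (p : nat) (u v : 'cV[R]_p) : R :=
  \sum_(k < p) u k 0 * v k 0.

(* MathComp-Analysis equips matrices with the sup norm `|_|, hence a separate
   Euclidean norm. *)
Definition norm2 (R : realType) (p : nat) (u : 'cV[R]_p) : R :=
  Num.sqrt (inner u u).

(* The i-th point is (x_i, a_i); a_i = true stands for 1, false for 0. *)
Definition dataset (R : realType) (n p : nat) : Type :=
  'I_n -> 'cV[R]_p * bool.

Definition covariate (R : realType) (n p : nat) (D : dataset R n p)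
  (i : 'I_n) : 'cV[R]_p := (D i).1.

Definition treatment (R : realType) (n p : nat) (D : dataset R n p)
  (i : 'I_n) : R := ((D i).2)%:R.

Definition differ_at_one_point (R : realType) (n p : nat)
    (D D' : dataset R n p) : Prop :=
  exists i0 : 'I_n, forall i : 'I_n, i != i0 -> D i = D' i.

Definition logistic_loss (R : realType) (n p : nat) (lamIPW : R)
    (D : dataset R n p) (lam : 'cV[R]_p) : R :=
  n%:R^-1 * \sum_(i < n)
      (ln (1 + expR (inner (covariate D i) lam))
       - treatment D i * inner (covariate D i) lam)
  + lamIPW / 2 * norm2 lam ^+ 2.

(* A relation, not a function: without strict convexity the argmin need not be
   unique. *)
Definition is_ipw_estimator (R : realType) (n p : nat) (RIPW lamIPW : R)
    (D : dataset R n p) (lamhat : 'cV[R]_p) : Prop :=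
  norm2 lamhat <= RIPW /\
  forall lam : 'cV[R]_p, norm2 lam <= RIPW ->
    logistic_loss lamIPW D lamhat <= logistic_loss lamIPW D lam.

(* 1 / (probability of the observed treatment) in the logistic model. *)
Definition inverse_propensity (R : realType) (n p : nat) (D : dataset R n p)
    (lam : 'cV[R]_p) (i : 'I_n) : R :=
  1 + expR (- (2 * treatment D i - 1) * inner (covariate D i) lam).

Definition ipw_weights (R : realType) (n p : nat) (D : dataset R n p)
    (lamhat : 'cV[R]_p) : 'cV[R]_n :=
  \col_i (n%:R * (inverse_propensity D lamhat i
                  / \sum_(j < n) inverse_propensity D lamhat j)).

Definition sample_covariance (R : realType) (n p : nat) (D : dataset R n p) :
    'M[R]_p :=
  n%:R^-1 *: \sum_(i < n) covariate D i *m (covariate D i)^T.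

Definition is_smallest_eigenvalue (R : realType) (p : nat) (A : 'M[R]_p)
    (l : R) : Prop :=
  eigenvalue A l /\ forall m : R, eigenvalue A m -> l <= m.

(* Main.v *)
Require Import Defs.
From mathcomp Require Import all_boot all_order all_algebra complex.
From mathcomp Require Import all_classical all_reals all_analysis.
From mathcomp Require Import ring lra.

(* The loss of D is rho-strongly convex on the ball (the logistic curvature is
   at least its value at M * RIPW, and the Gram form dominates lmin), hence its
   slope is rho-strongly monotone there. Comparing the first-order optimality
   conditions of lamhat with 0 gives |lamhat| <= deltaI; comparing those of
   lamhat and lamhat' gives |lamhat' - lamhat| <= 2M/(n rho), since the two
   slopes differ in a single summand. The weights are then compared through
   w(D', lamhat). Replacing one point at the parameter lamhat, of norm at most
   deltaI, produces the second term of the bound. Moving the parameter inside D'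
   changes every log-weight by at most 2M|lamhat' - lamhat| while the weights
   stay below exp(M RIPW), which produces the first term, even divided by
   sqrt n. *)

Set Implicit Arguments.
Unset Strict Implicit.
Unset Printing Implicit Defensive.

Import Order.TTheory GRing.Theory Num.Theory.
Local Open Scope ring_scope.

(** * Rayleigh bound for real symmetric matrices *)

Section Rayleigh.
Local Open Scope sesquilinear_scope.

(** Over the complex numbers [A] becomes Hermitian, hence unitarily diagonalizable with real
    spectrum. In the coordinates [w = P v] the form is the sum of [d_i |w_i|^2], and every [d_i] is
    at least [l]. *)
Lemma symmetric_rayleigh_ge (R : rcfType) (n : nat) (A : 'M[R]_n) (l : R)
    (v : 'cV[R]_n) :
  A^T = A -> (forall m, eigenvalue A m -> l <= m) ->
  l * (v^T *m v) 0 0 <= (v^T *m A *m v) 0 0.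
Proof.
move=> Asym lmin.
pose AC := map_mx (real_complex R) A; pose vC := map_mx (real_complex R) v.
have real_map (m k : nat) (B : 'M[R]_(m, k)) :
    map_mx (real_complex R) B \is a mxOver Num.real.
  by apply/mxOverP => i j; rewrite mxE; apply/complex_realP; exists (B i j).
have ACherm : AC \is hermsymmx.
  apply: realsym_hermsym; last exact: real_map.
  apply/is_hermitianmxP; rewrite expr0 scale1r map_mx_id //.
  by apply/matrixP => i j; rewrite !mxE -[in LHS]Asym mxE.
have := ACherm => /hermitian_normalmx/orthomx_spectralP.
set P := spectralmx AC; set d := spectral_diag AC => ACE.
have Pu : P \in unitmx by exact: spectral_unit.
have PtE : invmx P = P ^t* by apply/invmx_unitary/spectral_unitarymx.
have d_ge i : real_complex R l <= d 0 i.
  have /mxOverP/(_ 0 i)/complex_realP[k dk] :=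
    hermitian_spectral_diag_real ACherm.
  rewrite -/d in dk; rewrite dk lecR; apply: lmin.
  (* The hypothesis concerns eigenvalues of the real matrix, so the real number [k] is carried to
     [AC] as a root of the characteristic polynomial. There row [i] of [P] is an eigenvector,
     nonzero because [P] is invertible. *)
  rewrite eigenvalue_root_char -(fmorph_root (real_complex R)) map_char_poly.
  rewrite -eigenvalue_root_char; apply/eigenvalueP; exists (row i P); last first.
    apply/negP => /eqP Pi0; have /row_freeP[Q PQ] : row_free P.
      by rewrite row_free_unit.
    have /rowP/(_ i) : row i (P *m Q) = 0 by rewrite row_mul Pi0 mul0mx.
    by rewrite PQ !mxE eqxx => /eqP; rewrite oner_eq0.
  rewrite -[map_mx _ A]/AC -row_mul ACE !mulmxA mulmxV // mul1mx /= -dk.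
  by apply/rowP => j; rewrite mul_diag_mx !mxE.
pose w := P *m vC.
have vCt : vC ^t* = vC^T by rewrite map_trmx realmxC ?real_map.
have quad (D : 'rV_n) : (vC^T *m (invmx P *m diag_mx D *m P) *m vC) 0 0
    = \sum_i D 0 i * `|w i 0| ^+ 2.
  have -> : vC^T *m (invmx P *m diag_mx D *m P) *m vC = w ^t* *m diag_mx D *m w.
    by rewrite /w trmx_mul map_mxM vCt PtE !mulmxA.
  rewrite mxE; apply: eq_bigr => i _.
  by rewrite mul_mx_diag !mxE mulrAC mulrC normCKC.
rewrite -lecR rmorphM /=.
have -> : real_complex R ((v^T *m A *m v) 0 0)
    = \sum_i d 0 i * `|w i 0| ^+ 2.
  by rewrite -quad -ACE /AC /vC map_trmx -!map_mxM [RHS]mxE.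
have -> : real_complex R ((v^T *m v) 0 0) = \sum_i `|w i 0| ^+ 2.
  transitivity ((vC^T *m (invmx P *m diag_mx (const_mx 1) *m P) *m vC) 0 0).
    rewrite diag_const_mx mulmx1 mulVmx // mulmx1 /vC map_trmx -map_mxM.
    by rewrite [RHS]mxE.
  by rewrite quad; apply: eq_bigr => i _; rewrite mxE mul1r.
rewrite mulr_sumr; apply: ler_sum => i _.
by rewrite ler_wpM2r ?exprn_ge0.
Qed.

End Rayleigh.

(** * Euclidean inner product and norm *)

Section Euclidean.
Context {R : realType} {p : nat}.
Implicit Types (u v w : 'cV[R]_p) (a : R).

Lemma innerC u v : inner u v = inner v u.
Proof. by apply: eq_bigr => k _; rewrite mulrC. Qed.

Lemma innerDr w u v : inner w (u + v) = inner w u + inner w v.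
Proof. by rewrite -big_split; apply: eq_bigr => k _; rewrite mxE mulrDr. Qed.

Lemma innerZr u a v : inner u (a *: v) = a * inner u v.
Proof. by rewrite mulr_sumr; apply: eq_bigr => k _; rewrite mxE mulrCA. Qed.

Lemma inner0r u : inner u 0 = 0.
Proof. by rewrite -(scale0r 0) innerZr mul0r. Qed.

Lemma innerNr u v : inner u (- v) = - inner u v.
Proof. by rewrite -scaleN1r innerZr mulN1r. Qed.

Lemma innerBr w u v : inner w (u - v) = inner w u - inner w v.
Proof. by rewrite innerDr innerNr. Qed.

Lemma innerZZ a u : inner (a *: u) (a *: u) = a ^+ 2 * inner u u.
Proof. by rewrite innerZr innerC innerZr mulrA -expr2. Qed.

Lemma innerDD u v :
  inner (u + v) (u + v) = inner u u + 2 * inner u v + inner v v.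
Proof. rewrite innerDr !(innerC (u + v)) !innerDr (innerC v u); ring. Qed.

Lemma inner_ge0 u : 0 <= inner u u.
Proof. by apply: sumr_ge0 => k _; rewrite -expr2 sqr_ge0. Qed.

Lemma norm2_ge0 u : 0 <= norm2 u.
Proof. exact: sqrtr_ge0. Qed.

Lemma norm2_sqr u : norm2 u ^+ 2 = inner u u.
Proof. by rewrite sqr_sqrtr ?inner_ge0. Qed.

Lemma norm2_0 : norm2 (0 : 'cV[R]_p) = 0.
Proof. by rewrite /norm2 inner0r sqrtr0. Qed.

Lemma norm2Z a u : norm2 (a *: u) = `|a| * norm2 u.
Proof.
by rewrite /norm2 innerZZ sqrtrM ?sqr_ge0// sqrtr_sqr.
Qed.

Lemma norm2N u : norm2 (- u) = norm2 u.
Proof. by rewrite /norm2 innerNr innerC innerNr opprK. Qed.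

Lemma norm2_le u a : 0 <= a -> (norm2 u <= a) = (inner u u <= a ^+ 2).
Proof. by move=> a0; rewrite -norm2_sqr ler_pXn2r ?nnegrE ?norm2_ge0. Qed.

Lemma norm2_col_le u a : 0 <= a -> (forall i, `|u i 0| <= a) ->
  norm2 u <= Num.sqrt p%:R * a.
Proof.
move=> a0 ua; rewrite norm2_le ?mulr_ge0 ?sqrtr_ge0//.
rewrite exprMn sqr_sqrtr ?ler0n// mulr_natl -[p in _ *+ p]card_ord -sumr_const.
apply: ler_sum => i _; rewrite -expr2 -real_normK ?num_real//.
by rewrite lerXn2r ?nnegrE.
Qed.

Lemma inner_norm_le u v : `|inner u v| <= norm2 u * norm2 v.
Proof.
rewrite -(@ler_pXn2r _ 2)// ?nnegrE ?mulr_ge0 ?norm2_ge0//.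
rewrite real_normK ?num_real// exprMn !norm2_sqr.
(* This square expands to [<v,v> (<u,u><v,v> - <u,v>^2)]; dividing by [<v,v>] gives Cauchy-Schwarz,
   the case [<v,v> = 0] being treated apart. *)
have := inner_ge0 (inner v v *: u + (- inner u v) *: v).
rewrite innerDD !innerZZ innerZr [inner (_ *: _) v]innerC innerZr (innerC v u).
have := inner_ge0 v; rewrite le_eqVlt => /predU1P[v0 _|v0].
  have [->|] := eqVneq v 0; first by rewrite !inner0r expr0n mulr0.
  suff -> : v = 0 by rewrite eqxx.
  apply/colP => k; rewrite mxE; apply/eqP; rewrite -sqrf_eq0 expr2.
  move/esym/eqP: v0; rewrite psumr_eq0 => [/allP/(_ k)|i _].
    by rewrite mem_index_enum => /(_ isT).
  by rewrite -expr2 sqr_ge0.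
move=> h; rewrite -(ler_pM2l v0) -subr_ge0; lra.
Qed.

Lemma norm2D u v : norm2 (u + v) <= norm2 u + norm2 v.
Proof.
rewrite norm2_le ?addr_ge0 ?norm2_ge0// sqrrD !norm2_sqr.
rewrite innerDD.
have := le_trans (ler_norm _) (inner_norm_le u v); lra.
Qed.

End Euclidean.

(** * Smoothness and curvature of the logistic function *)

Section Logistic.
Context {R : realType}.
Implicit Types z h a b K : R.

Definition sigmoid z := (1 + expR (- z))^-1.

Lemma sigmoid_gt0 z : 0 < sigmoid z.
Proof. by rewrite invr_gt0 addr_gt0 ?expR_gt0. Qed.

Lemma sigmoid_lt1 z : sigmoid z < 1.
Proof. by rewrite invf_lt1 ?addr_gt0 ?expR_gt0// ltrDl expR_gt0. Qed.

(** A first-order expansion with quadratic error, which stands in for differentiating the loss. It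
    follows from [1 + e^(z+h) = (1 + e^z)(1 + sigmoid z (e^h - 1))] and [ln (1 + x) <= x]. *)
Lemma softplus_le z h : h <= 2^-1 ->
  ln (1 + expR (z + h)) <= ln (1 + expR z) + sigmoid z * h + 2 * h ^+ 2.
Proof.
move=> h2; have ez := expR_gt0 z.
have s0 := sigmoid_gt0 z; have s1 := sigmoid_lt1 z.
have sE : sigmoid z * (1 + expR z) = expR z.
  rewrite /sigmoid expRN; field; lra.
have -> : 1 + expR (z + h) = (1 + expR z) * (1 + sigmoid z * (expR h - 1)).
  by rewrite mulrDr mulr1 mulrA [_ * sigmoid z]mulrC sE expRD; ring.
have eh := expR_gt0 h.
have seh := mulr_gt0 s0 eh.
have sp : 0 < 1 + sigmoid z * (expR h - 1) by lra.
have ez1 : 0 < 1 + expR z by lra.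
rewrite lnM ?posrE//.
rewrite -!addrA lerD2l; apply: le_trans (le_ln1Dx _) _; first by lra.
(* Here [(1 - h) e^h <= 1], while [(1 - h)(1 + h + 2 h^2) = 1 + h^2 (1 - 2 h)] is at least 1 exactly
   because [h <= 1/2] (or [h = 0]). *)
have ehle : expR h <= 1 + h + 2 * h ^+ 2.
  have h1 : 0 < 1 - h by lra.
  rewrite -(ler_pM2r h1); apply: (@le_trans _ _ 1).
    rewrite -[leRHS](expRxMexpNx_1 h) ler_pM2l//; exact: expR_ge1Dx.
  have h3 : 0 <= 1 - 2 * h by lra.
  by have := mulr_ge0 (sqr_ge0 h) h3; lra.
have : sigmoid z * expR h <= sigmoid z * (1 + h + 2 * h ^+ 2).
  by rewrite ler_pM2l.
have : sigmoid z * h ^+ 2 <= h ^+ 2 by rewrite ler_piMl ?sqr_ge0// ltW.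
lra.
Qed.

(** With [x = e^(-K)] and [y = e^(-z)], clearing denominators leaves [(y - x)(1 - x y) >= 0]; both
    factors are nonnegative since [-K <= z <= K]. *)
Lemma logistic_curvature_ge K z : `|z| <= K ->
  expR (- K) / (1 + expR (- K)) ^+ 2 <= expR (- z) / (1 + expR (- z)) ^+ 2.
Proof.
rewrite ler_norml => /andP[Kz zK].
have x0 := expR_gt0 (- K); have y0 := expR_gt0 (- z).
have xy : expR (- K) <= expR (- z) by rewrite ler_expR lerN2.
have xy1 : expR (- K) * expR (- z) <= 1.
  by rewrite -expRD -expR0 ler_expR; lra.
rewrite ler_pdivrMr ?exprn_gt0 ?addr_gt0//.
rewrite mulrAC ler_pdivlMr ?exprn_gt0 ?addr_gt0//; nra.
Qed.

(** Mean value theorem: the intermediate point stays in [[-K, K]], where the derivative of [sigmoid]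
    is bounded below by the curvature at [K]. *)
Lemma sigmoid_monotone K a b : `|a| <= K -> `|b| <= K ->
  expR (- K) / (1 + expR (- K)) ^+ 2 * (b - a) ^+ 2
  <= (sigmoid b - sigmoid a) * (b - a).
Proof.
wlog ab : a b / a <= b.
  move=> wl aK bK; have [ab|/ltW ba] := leP a b; first exact: wl.
  by have := wl _ _ ba bK aK; lra.
move=> aK bK.
have dsig (x : R) : is_derive x 1 sigmoid (expR (- x) / (1 + expR (- x)) ^+ 2).
  have n0 : 1 + expR (- x) != 0 by rewrite gt_eqF ?addr_gt0 ?expR_gt0.
  have dden : is_derive x 1 (fun y => 1 + expR (- y)) (- expR (- x)).
    have := is_deriveD (is_derive_cst (1 : R) x 1)
      (is_derive1_comp (is_derive_expR (- x)) (is_deriveN (is_derive_id x 1))).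
    by rewrite add0r mulrN1.
  have -> : expR (- x) / (1 + expR (- x)) ^+ 2
      = - (1 + expR (- x)) ^- 2 *: - expR (- x).
    by rewrite scalerN scaleNr opprK mulrC.
  exact: (@is_deriveV _ (fun y => 1 + expR (- y)) _ _ _ n0 dden).
have [|c] := MVT_segment ab (fun x _ => dsig x).
  by apply: derivable_within_continuous => x _; have [] := dsig x.
rewrite in_itv /= => /andP[ac cb] ->; rewrite -[leRHS]mulrA -expr2.
rewrite ler_wpM2r ?sqr_ge0//; apply: logistic_curvature_ge.
by move: aK bK; rewrite !ler_norml => /andP[? ?] /andP[? ?]; apply/andP; split; lra.
Qed.

End Logistic.

(** * First-order optimality and strong monotonicity of the slope *)

Section Estimator.
Context {R : realType} {n p : nat} (lamIPW : R).
Implicit Types (D : dataset R n p) (lam mu v : 'cV[R]_p).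

(* The derivative of [logistic_loss lamIPW D] at [lam] in the direction [v]. *)
Definition loss_slope D lam v : R :=
  n%:R^-1 * \sum_(i < n)
    (sigmoid (inner (covariate D i) lam) - treatment D i)
      * inner (covariate D i) v
  + lamIPW * inner lam v.

Lemma loss_slopeN D lam v : loss_slope D lam (- v) = - loss_slope D lam v.
Proof.
rewrite /loss_slope innerNr mulrN opprD; congr (_ - _); rewrite -mulrN -sumrN.
by congr (_ * _); apply: eq_bigr => i _; rewrite innerNr mulrN.
Qed.

(** If [g < 0], a step [t] with [2 t (|c| + 1) <= -g] makes the linear term outweigh the quadratic
    one. *)
Lemma slope_ge0 (g c T : R) : 0 < T ->
  (forall t, 0 < t -> t <= T -> 0 <= t * g + t ^+ 2 * c) -> 0 <= g.
Proof.
move=> T0 tgc; rewrite leNgt; apply/negP => g0.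
have c1 : 0 < 2 * (`|c| + 1) by rewrite mulr_gt0// ltr_wpDl.
pose t := Num.min T (- g / (2 * (`|c| + 1))).
have t0 : 0 < t by rewrite lt_min T0 divr_gt0// oppr_gt0.
have tT : t <= T by rewrite ge_min lexx.
have tc : t * (2 * (`|c| + 1)) <= - g.
  by rewrite -ler_pdivlMr// ge_min lexx orbT.
have := tgc t t0 tT; rewrite expr2 -mulrA -mulrDr pmulr_rge0//.
have := ler_wpM2l (ltW t0) (ler_norm c); lra.
Qed.

Lemma logistic_loss_le D lam v t :
  (forall i, t * inner (covariate D i) v <= 2^-1) ->
  logistic_loss lamIPW D (lam + t *: v) <= logistic_loss lamIPW D lam
    + t * loss_slope D lam v
    + t ^+ 2 * (n%:R^-1 * (\sum_(i < n) 2 * inner (covariate D i) v ^+ 2)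
                + lamIPW / 2 * inner v v).
Proof.
move=> tv; rewrite /logistic_loss /loss_slope !norm2_sqr.
set S1 := \sum_(i < n) _; set S2 := \sum_(i < n) _.
set S3 := \sum_(i < n) _; set S4 := \sum_(i < n) _.
have : n%:R^-1 * S1 <= n%:R^-1 * (S2 + t * S3 + t ^+ 2 * S4).
  rewrite ler_wpM2l ?invr_ge0 ?ler0n// !mulr_sumr -!big_split/=.
  apply: ler_sum => i _; rewrite innerDr innerZr.
  have := softplus_le (inner (covariate D i) lam) (tv i); lra.
by rewrite innerDD innerZZ innerZr; lra.
Qed.

(** The ball is convex, so small steps from [lamhat] towards [mu] stay feasible and cannot lower the
    loss; the quadratic upper expansion then forces a nonnegative slope. *)
Lemma ipw_estimator_slope_ge0 RIPW D lamhat mu :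
  is_ipw_estimator RIPW lamIPW D lamhat -> norm2 mu <= RIPW ->
  0 <= loss_slope D lamhat (mu - lamhat).
Proof.
move=> [lamR lammin] muR; set v := mu - lamhat.
pose H := \sum_(i < n) `|inner (covariate D i) v|.
have H0 : 0 <= H by apply: sumr_ge0.
(* This maximal step gives both [t <= 1/2], keeping the point on the segment, and [t H <= 1/2], the
   range in which [softplus_le] applies to every summand. *)
have T0 : 0 < (2 * (1 + H))^-1 by rewrite invr_gt0; lra.
pose c := n%:R^-1 * (\sum_(i < n) 2 * inner (covariate D i) v ^+ 2)
          + lamIPW / 2 * inner v v.
apply: (@slope_ge0 _ c _ T0) => t t0 tT.
have tH : t * (2 * (1 + H)) <= 1 by rewrite -ler_pdivlMr// ?mul1r//; lra.
have tHpos := mulr_ge0 (ltW t0) H0.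
have ball : norm2 (lamhat + t *: v) <= RIPW.
  have -> : lamhat + t *: v = (1 - t) *: lamhat + t *: mu.
    by rewrite /v scalerBr scalerBl scale1r addrA addrAC.
  apply: le_trans (norm2D _ _) _; rewrite !norm2Z !ger0_norm; last 2 first.
  - lra.
  - lra.
  have t1 : 0 <= 1 - t by lra.
  have := ler_wpM2l t1 lamR; have := ler_wpM2l (ltW t0) muR; lra.
have /logistic_loss_le : forall i, t * inner (covariate D i) v <= 2^-1.
  move=> i; have : `|inner (covariate D i) v| <= H.
    by rewrite /H (bigD1 i)//= lerDl sumr_ge0.
  move/(le_trans (ler_norm _))/(ler_wpM2l (ltW t0)); lra.
move=> /(_ lamhat); rewrite -/c; have := lammin _ ball; lra.
Qed.

Lemma sample_covariance_ge D lmin v :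
  is_smallest_eigenvalue (sample_covariance D) lmin ->
  lmin * inner v v <= n%:R^-1 * \sum_(i < n) inner (covariate D i) v ^+ 2.
Proof.
move=> [_ lmin_le].
have innerE (u w : 'cV[R]_p) : (u^T *m w) 0 0 = inner u w.
  by rewrite mxE; apply: eq_bigr => k _; rewrite mxE.
have sym : (sample_covariance D)^T = sample_covariance D.
  rewrite /sample_covariance linearZ/= linear_sum/=; congr (_ *: _).
  by apply: eq_bigr => i _; rewrite trmx_mul trmxK.
have := @symmetric_rayleigh_ge R p _ _ v sym lmin_le.
rewrite innerE; congr (_ <= _).
rewrite /sample_covariance -scalemxAr -scalemxAl mxE; congr (_ * _).
rewrite mulmx_sumr mulmx_suml summxE; apply: eq_bigr => i _.
by rewrite -!mulmxA mulmxA mxE big_ord1 !innerE innerC expr2.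
Qed.

Lemma loss_slope_monotone D (M RIPW lmin : R) lam mu :
  0 <= M -> (forall i, norm2 (covariate D i) <= M) ->
  is_smallest_eigenvalue (sample_covariance D) lmin ->
  norm2 lam <= RIPW -> norm2 mu <= RIPW ->
  (expR (- (M * RIPW)) / (1 + expR (- (M * RIPW))) ^+ 2 * lmin + lamIPW)
    * norm2 (mu - lam) ^+ 2
  <= loss_slope D mu (mu - lam) - loss_slope D lam (mu - lam).
Proof.
move=> M0 hM hl lamR muR; rewrite norm2_sqr.
set k := expR _ / _; set v := mu - lam.
have k0 : 0 <= k by rewrite divr_ge0 ?expR_ge0 ?exprn_ge0 ?addr_ge0 ?expR_ge0.
have bound (w : 'cV[R]_p) i : norm2 w <= RIPW ->
    `|inner (covariate D i) w| <= M * RIPW.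
  move=> wR; apply: le_trans (inner_norm_le _ _) _.
  by rewrite ler_pM ?norm2_ge0.
have inner_v : inner mu v - inner lam v = inner v v.
  by rewrite -!(innerC v) -innerBr.
rewrite /loss_slope.
set S1 := \sum_(i < n) _; set S2 := \sum_(i < n) _.
(* The treatments cancel in the difference of slopes, leaving sigmoid increments between points of
   absolute value at most [M * RIPW]. *)
have : n%:R^-1 * (\sum_(i < n) k * inner (covariate D i) v ^+ 2)
    <= n%:R^-1 * (S1 - S2).
  rewrite ler_wpM2l ?invr_ge0 ?ler0n// /S1 /S2 -sumrB; apply: ler_sum => i _.
  have := sigmoid_monotone (bound _ i lamR) (bound _ i muR).
  rewrite -innerBr -/v -/k; lra.
rewrite -mulr_sumr.
have := ler_wpM2l k0 (sample_covariance_ge v hl); rewrite -inner_v; lra.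
Qed.

End Estimator.

(** * Size of the estimator and its stability under replacing one point *)

Section EstimatorBounds.
Context {R : realType} {n p : nat} (M RIPW lamIPW lmin : R).
Context (D : dataset R n p) (lamhat : 'cV[R]_p).
Context (lamIPW_ge0 : 0 <= lamIPW) (n_gt0 : (0 < n)%N).
Context (covariate_le : forall i, norm2 (covariate D i) <= M).
Context (lamhatP : is_ipw_estimator RIPW lamIPW D lamhat).
Context (lminP : is_smallest_eigenvalue (sample_covariance D) lmin).
Context (lmin_gt0 : 0 < lmin).

Let rho := expR (- (M * RIPW)) / (1 + expR (- (M * RIPW))) ^+ 2 * lmin + lamIPW.

Let M_ge0 : 0 <= M.
Proof. exact: le_trans (norm2_ge0 _) (covariate_le (Ordinal n_gt0)). Qed.

Let RIPW_ge0 : 0 <= RIPW.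
Proof. exact: le_trans (norm2_ge0 _) (proj1 lamhatP). Qed.

Lemma strong_convexity_gt0 : 0 < rho.
Proof.
by rewrite ltr_wpDr// mulr_gt0// divr_gt0 ?exprn_gt0 ?addr_gt0 ?expR_gt0.
Qed.

Let norm2_le_of_sqr (v : 'cV[R]_p) (c : R) : 0 <= c ->
  rho * norm2 v ^+ 2 <= c * norm2 v -> norm2 v <= c / rho.
Proof.
move=> c0; have := norm2_ge0 v; rewrite le_eqVlt => /predU1P[<- _|v0].
  by rewrite divr_ge0// ltW// strong_convexity_gt0.
rewrite expr2 mulrA ler_pM2r// => h.
by rewrite ler_pdivlMr ?strong_convexity_gt0// mulrC.
Qed.

Lemma mean_le (F : 'I_n -> R) (c : R) : (forall i, F i <= c) ->
  n%:R^-1 * \sum_(i < n) F i <= c.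
Proof.
move=> Fc; rewrite mulrC ler_pdivrMr ?ltr0n// mulr_natr -[n in _ *+ n]card_ord.
by rewrite -sumr_const; apply: ler_sum.
Qed.

Lemma norm2_ipw_estimator_le : norm2 lamhat <= Num.min RIPW ((M / 2) / rho).
Proof.
rewrite le_min (proj1 lamhatP)/=.
apply: norm2_le_of_sqr; first by rewrite divr_ge0.
have zeroR : norm2 (0 : 'cV[R]_p) <= RIPW by rewrite norm2_0.
have := loss_slope_monotone lamIPW M_ge0 covariate_le lminP zeroR
  (proj1 lamhatP).
have := ipw_estimator_slope_ge0 lamhatP zeroR.
rewrite subr0 sub0r loss_slopeN -/rho => opt mono.
have : - loss_slope lamIPW D 0 lamhat <= M / 2 * norm2 lamhat.
  rewrite -loss_slopeN /loss_slope [inner 0 _]innerC inner0r mulr0 addr0.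
  apply: mean_le => i.
  (* At the zero parameter every sigmoid equals 1/2, so each residual has absolute value 1/2: this
     is the origin of [M / 2]. *)
  rewrite innerNr inner0r /sigmoid oppr0 expR0 -mulr2n /treatment.
  have /ler_normlP[x1 x2] := inner_norm_le (covariate D i) lamhat.
  have := ler_wpM2r (norm2_ge0 lamhat) (covariate_le i).
  case: (D i).2 => /=; lra.
lra.
Qed.

(** Along [v = lamhat' - lamhat], optimality makes the slope of [D] at [lamhat] nonnegative and that
    of [D'] at [lamhat'] nonpositive. Monotonicity thus bounds [rho |v|^2] by the difference of the
    two slopes at [lamhat'], where only the summands at [i0] survive, each at most [M |v|]. *)
Lemma ipw_estimator_stable (D' : dataset R n p) (lamhat' : 'cV[R]_p) :
  differ_at_one_point D D' ->
  (forall i, norm2 (covariate D' i) <= M) ->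
  is_ipw_estimator RIPW lamIPW D' lamhat' ->
  norm2 (lamhat' - lamhat) <= 2 * M / n%:R / rho.
Proof.
move=> [i0 DD'] covariate'_le lamhat'P.
apply: norm2_le_of_sqr; first by rewrite divr_ge0 ?mulr_ge0.
have := loss_slope_monotone lamIPW M_ge0 covariate_le lminP
  (proj1 lamhatP) (proj1 lamhat'P).
have := ipw_estimator_slope_ge0 lamhatP (proj1 lamhat'P).
have := ipw_estimator_slope_ge0 lamhat'P (proj1 lamhatP).
rewrite -(opprB lamhat') loss_slopeN -/rho; set v := lamhat' - lamhat.
move=> opt' opt mono.
suff : loss_slope lamIPW D lamhat' v - loss_slope lamIPW D' lamhat' v
    <= 2 * M / n%:R * norm2 v by lra.
pose term (E : dataset R n p) i := (sigmoid (inner (covariate E i) lamhat')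
  - treatment E i) * inner (covariate E i) v.
have termP (E : dataset R n p) i : norm2 (covariate E i) <= M ->
    `|term E i| <= M * norm2 v.
  move=> EM; rewrite normrM -[leRHS]mul1r ler_pM//.
    have := sigmoid_gt0 (inner (covariate E i) lamhat').
    have := sigmoid_lt1 (inner (covariate E i) lamhat').
    rewrite ler_norml /treatment.
    by case: (E i).2 => /= *; apply/andP; split; lra.
  apply: le_trans (inner_norm_le _ _) _.
  by rewrite ler_wpM2r ?norm2_ge0.
have -> : loss_slope lamIPW D lamhat' v - loss_slope lamIPW D' lamhat' v
    = n%:R^-1 * (term D i0 - term D' i0).
  rewrite /loss_slope -!/(term _ _) (bigD1 i0)//=.
  rewrite [X in _ - (_ * X + _)](bigD1 i0)//=.
  rewrite [X in _ * (_ + X) + _ - _](eq_bigr (term D')) => [|i /DD' DDi].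
    by rewrite /term; ring.
  by rewrite /term /covariate /treatment DDi.
have /ler_normlP[_ h1] := termP D i0 (covariate_le i0).
have /ler_normlP[h2 _] := termP D' i0 (covariate'_le i0).
rewrite mulrAC mulrC ler_wpM2r ?invr_ge0//; lra.
Qed.

End EstimatorBounds.

(** * Perturbation of normalized positive vectors *)

Section NormalizedWeights.
Context {R : realType} {n : nat}.
Implicit Types u : 'I_n -> R.

(** Convertible to [ipw_weights] when [u] is the vector of inverse propensities. *)
Definition normalized u : 'cV[R]_n := \col_i (n%:R * (u i / \sum_(j < n) u j)).

Lemma sum_ge_nmul u (b : R) :
  (forall i, b <= u i) -> n%:R * b <= \sum_(i < n) u i.
Proof.
move=> bu; rewrite mulr_natl -[n in _ *+ n]card_ord -sumr_const.
exact: ler_sum.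
Qed.

Lemma normalized_change_one u u' (i0 : 'I_n) (B : R) :
  (forall i, i != i0 -> u i = u' i) ->
  (forall i, 1 <= u i <= B) -> 1 <= u' i0 ->
  norm2 (normalized u - normalized u')
  <= `|u' i0 - u i0| * (1 + B / (2 * n%:R)).
Proof.
move=> uu' uB u'1; set d := u' i0 - u i0.
have u1 i : 1 <= u i by case/andP: (uB i).
have u_le i : u i <= B by case/andP: (uB i).
have B1 : 1 <= B := le_trans (u1 i0) (u_le i0).
have n0 : 0 < n%:R :> R by rewrite ltr0n (leq_ltn_trans _ (ltn_ord i0)).
have u'_ge1 i : 1 <= u' i.
  by have [->//|/uu' <-] := eqVneq i i0; exact: u1.
have := sum_ge_nmul u1; have := sum_ge_nmul u'_ge1.
set S := \sum_(j < n) u j; set S' := \sum_(j < n) u' j.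
rewrite !mulr1 => nS' nS.
have S0 : 0 < S by lra.
have S'0 : 0 < S' by lra.
have SS' : S' = S + d.
  rewrite /S' /S (bigD1 i0)//= [X in _ = X + _](bigD1 i0)//=.
  by rewrite (eq_bigr u) => [|i /uu'//]; rewrite /d; ring.
(* Since [S' = S + d], the difference of the two normalized vectors is exactly the multiple [c] of
   [g]. *)
pose c := n%:R / (S * S') * d.
pose g i := if i == i0 then u i0 - S else u i.
have entry i : (normalized u - normalized u') i 0 = c * g i.
  rewrite !mxE -/S -/S' /c /g; have [->|/uu' <-] := eqVneq i i0.
    have -> : u' i0 = u i0 + d by rewrite /d; ring.
    by rewrite SS'; field; rewrite -SS'; lra.
  by rewrite SS'; field; rewrite -SS'; lra.
have B2n : 0 <= B / (2 * n%:R) by rewrite divr_ge0 ?mulr_ge0//; lra.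
rewrite norm2_le; last by rewrite mulr_ge0// addr_ge0.
have -> : inner (normalized u - normalized u') (normalized u - normalized u')
    = c ^+ 2 * \sum_(i < n) g i ^+ 2.
  rewrite mulr_sumr; apply: eq_bigr => i _; rewrite entry; ring.
have uS : u i0 <= S.
  by rewrite /S (bigD1 i0)//= lerDl sumr_ge0// => i _; have := u1 i; lra.
(* The entry at [i0] lies in [[-S, 0]]; the others satisfy [u_i^2 <= B u_i]. *)
have gle : \sum_(i < n) g i ^+ 2 <= S ^+ 2 + B * S.
  rewrite (bigD1 i0)//= {1}/g eqxx; apply: lerD.
    have := u1 i0; nra.
  rewrite /S mulr_sumr [leRHS](bigD1 i0)//=; apply: ler_wpDl.
    by rewrite mulr_ge0//; [lra | have := u1 i0; lra].
  apply: ler_sum => i ii0; rewrite /g (negbTE ii0) expr2 ler_wpM2r//.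
  by have := u1 i; lra.
apply: le_trans (ler_wpM2l (sqr_ge0 _) gle) _.
have -> : c ^+ 2 * (S ^+ 2 + B * S) = (n%:R / S') ^+ 2 * d ^+ 2 * (1 + B / S).
  by rewrite /c; field; lra.
rewrite [leRHS]exprMn real_normK ?num_real//.
have q1 : (n%:R / S') ^+ 2 <= 1.
  by rewrite exprn_ile1 ?divr_ge0 ?ler_pdivrMr ?mul1r//; lra.
have BS : B / S <= B / n%:R by rewrite ler_wpM2l ?lef_pV2//; lra.
have BS0 : 0 <= B / S by rewrite divr_ge0//; lra.
apply: ler_pM.
- by rewrite mulr_ge0 ?sqr_ge0.
- by rewrite addr_ge0.
- by rewrite ler_piMl ?sqr_ge0.
(* With [q = B / n], completing the square gives [1 + q <= (1 + q / 2)^2], whence the 2 in the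
   denominator of the bound. *)
have -> : 1 + B / S = 1 + B / n%:R + (B / S - B / n%:R) by ring.
have -> : B / (2 * n%:R) = B / n%:R / 2 by field; lra.
have := sqr_ge0 (B / n%:R); lra.
Qed.

Lemma normalized_le u (b B : R) : 0 < b -> (forall i, b <= u i <= B) ->
  forall i, normalized u i 0 <= B / b.
Proof.
move=> b0 ubB i; rewrite mxE.
have n0 : 0 < n%:R :> R by rewrite ltr0n (leq_ltn_trans _ (ltn_ord i)).
have bS : n%:R * b <= \sum_(j < n) u j.
  by apply: sum_ge_nmul => j; case/andP: (ubB j).
have nb0 := mulr_gt0 n0 b0.
have S0 : 0 < \sum_(j < n) u j by apply: lt_le_trans bS.
have [bu uB] := andP (ubB i).
rewrite mulrA ler_pdivrMr// mulrAC ler_pdivlMr//.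
rewrite -mulrA [u i * b]mulrC mulrA mulrC ler_pM//; lra.
Qed.

(** Numerator and total each move by a factor at most [e^e], so a weight shrinks by at most
    [e^(-2e) >= 1 - 2e]; the weight itself is at most [B / b]. *)
Lemma normalized_sub_le u u' (b B e : R) : 0 < b -> 0 <= e ->
  (forall i, b <= u i <= B) -> (forall i, b <= u' i) ->
  (forall i, u i <= expR e * u' i) -> (forall i, u' i <= expR e * u i) ->
  forall i, normalized u i 0 - normalized u' i 0 <= 2 * e * (B / b).
Proof.
move=> b0 e0 ubB bu' uu' u'u i.
have n0 : 0 < n%:R :> R by rewrite ltr0n (leq_ltn_trans _ (ltn_ord i)).
have wle := normalized_le b0 ubB i.
have bu j : b <= u j by case/andP: (ubB j).
have S0 : 0 < \sum_(j < n) u j.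
  by apply: lt_le_trans (sum_ge_nmul bu); rewrite mulr_gt0.
have S'0 : 0 < \sum_(j < n) u' j.
  by apply: lt_le_trans (sum_ge_nmul bu'); rewrite mulr_gt0.
have w0 : 0 <= normalized u i 0.
  rewrite mxE mulr_ge0 ?ler0n ?divr_ge0 ?(ltW S0)//; have := bu i; lra.
have ww' : expR (- (2 * e)) * normalized u i 0 <= normalized u' i 0.
  rewrite !mxE mulrCA ler_wpM2l ?ler0n// ler_pdivlMr//.
  have ee : expR (- (2 * e)) = expR (- e) * expR (- e).
    by rewrite -expRD; congr expR; ring.
  have eu : expR (- e) * u i <= u' i.
    by rewrite expRN mulrC ler_pdivrMr ?expR_gt0// mulrC.
  have eS : expR (- e) * \sum_(j < n) u' j <= \sum_(j < n) u j.
    by rewrite expRN mulrC ler_pdivrMr ?expR_gt0// mulrC mulr_sumr ler_sum.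
  have -> : expR (- (2 * e)) * (u i / \sum_(j < n) u j) * \sum_(j < n) u' j
      = expR (- e) * u i * (expR (- e) * (\sum_(j < n) u' j) / \sum_(j < n) u j).
    by rewrite ee; ring.
  rewrite -[leRHS]mulr1 ler_pM// ?ler_pdivrMr ?mul1r//.
  - by rewrite mulr_ge0 ?expR_ge0//; have := bu i; lra.
  - by rewrite !mulr_ge0 ?expR_ge0 ?invr_ge0 ?ltW.
have := expR_ge1Dx (- (2 * e)).
move=> /(ler_wpM2r w0) h; have := ler_wpM2l (mulr_ge0 (ler0n R 2) e0) wle; lra.
Qed.

End NormalizedWeights.

(** * Effect on the weights of changing one point or the parameter *)

Section InversePropensity.
Context {R : realType} {n p : nat}.
Implicit Types (D : dataset R n p) (lam : 'cV[R]_p).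

Lemma ipw_exponentE D i :
  exists2 s : R, `|s| = 1 &
    forall mu, - (2 * treatment D i - 1) * inner (covariate D i) mu
               = s * inner (covariate D i) mu.
Proof.
rewrite /treatment; case: (D i).2 => /=.
  by exists (-1); rewrite ?normrN1// => ?; ring.
by exists 1; rewrite ?normr1// => ?; ring.
Qed.

Lemma inverse_propensity_bound D (M r : R) lam i :
  norm2 (covariate D i) <= M -> norm2 lam <= r ->
  1 + expR (- (M * r)) <= inverse_propensity D lam i <= 1 + expR (M * r).
Proof.
move=> xM lamr; rewrite /inverse_propensity.
have [s s1 ->] := ipw_exponentE D i.
rewrite !lerD2l !ler_expR -ler_norml normrM s1 mul1r.
by apply: le_trans (inner_norm_le _ _) _; rewrite ler_pM ?norm2_ge0.
Qed.

Lemma inverse_propensity_le D (M : R) lam mu i :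
  norm2 (covariate D i) <= M ->
  inverse_propensity D mu i
  <= expR (M * norm2 (mu - lam)) * inverse_propensity D lam i.
Proof.
move=> xM; rewrite /inverse_propensity; have [s s1 sE] := ipw_exponentE D i.
rewrite !sE mulrDr mulr1 -expRD lerD//.
  rewrite -[leLHS]expR0 ler_expR mulr_ge0 ?norm2_ge0//.
  by rewrite (le_trans _ xM) ?norm2_ge0.
rewrite ler_expR -lerBlDr -mulrBr -innerBr.
apply: le_trans (ler_norm _) _; rewrite normrM s1 mul1r.
by apply: le_trans (inner_norm_le _ _) _; rewrite ler_wpM2r ?norm2_ge0.
Qed.

Lemma ipw_weights_change_one D D' (M r : R) lam :
  differ_at_one_point D D' ->
  (forall i, norm2 (covariate D i) <= M) ->
  (forall i, norm2 (covariate D' i) <= M) -> norm2 lam <= r ->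
  norm2 (ipw_weights D lam - ipw_weights D' lam)
  <= 2 * M * r * expR (M * r) * (1 + (1 + expR (M * r)) / (2 * n%:R)).
Proof.
move=> [i0 DD'] xM xM' lamr.
have uB i := inverse_propensity_bound (xM i) lamr.
have uB' i := inverse_propensity_bound (xM' i) lamr.
have e0 := expR_gt0 (- (M * r)).
apply: le_trans (@normalized_change_one _ _ _ _ i0 (1 + expR (M * r)) _ _ _) _.
- by move=> i /DD' DDi; rewrite /inverse_propensity /covariate /treatment DDi.
- by move=> i; case/andP: (uB i) => [lo ->]; rewrite andbT; lra.
- by case/andP: (uB' i0) => [lo _]; lra.
apply: ler_wpM2r.
  by rewrite addr_ge0// divr_ge0 ?mulr_ge0// addr_ge0// expR_ge0.
(* The left side is the length of the interval containing both inverse propensities at [i0]; factor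
   out [e^(M r)] and use [1 - e^(-2 M r) <= 2 M r]. *)
have : expR (M * r) - expR (- (M * r)) <= 2 * M * r * expR (M * r).
  have := expR_ge1Dx (- (2 * (M * r))).
  have -> : - (2 * (M * r)) = - (M * r) - M * r by ring.
  move/(ler_wpM2l (expR_ge0 (M * r))).
  by rewrite expRD mulrA expRxMexpNx_1; lra.
have /andP[l1 u1] := uB i0; have /andP[l2 u2] := uB' i0.
by rewrite ler_norml => ?; apply/andP; split; lra.
Qed.

Lemma ipw_weights_change_parameter D (M r : R) lam mu : (0 < n)%N ->
  (forall i, norm2 (covariate D i) <= M) -> norm2 lam <= r -> norm2 mu <= r ->
  norm2 (ipw_weights D lam - ipw_weights D mu)
  <= Num.sqrt n%:R * (2 * (M * norm2 (mu - lam)) * expR (M * r)).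
Proof.
move=> n0 xM lamr mur.
have M0 : 0 <= M := le_trans (norm2_ge0 _) (xM (Ordinal n0)).
set e := M * norm2 (mu - lam); set b := 1 + expR (- (M * r)).
have e0 : 0 <= e by rewrite mulr_ge0 ?norm2_ge0.
have b0 : 0 < b by rewrite addr_gt0 ?expR_gt0.
have uB i := inverse_propensity_bound (xM i) lamr.
have vB i := inverse_propensity_bound (xM i) mur.
have uv i := inverse_propensity_le mu lam (xM i).
have vu i := inverse_propensity_le lam mu (xM i).
(* This identifies [e^(M r)] with the ratio [B / b] of the upper to the lower bound on inverse
   propensities. *)
have -> : expR (M * r) = (1 + expR (M * r)) / b.
  by rewrite /b expRN; field; have := expR_gt0 (M * r); lra.
apply: norm2_col_le => [|i].
  have B0 : 0 <= 1 + expR (M * r) by rewrite addr_ge0 ?expR_ge0.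
  by apply: mulr_ge0; [exact: mulr_ge0 | exact/divr_ge0/ltW].
have sub_le := @normalized_sub_le R n _ _ b (1 + expR (M * r)) e b0 e0.
have uv' k : inverse_propensity D lam k <= expR e * inverse_propensity D mu k.
  by rewrite /e -norm2N opprB.
rewrite mxE [X in _ + X]mxE ler_norml lerNl opprB.
apply/andP; split; apply: sub_le => // j.
- by case/andP: (uB j).
- by case/andP: (vB j).
Qed.

End InversePropensity.

(** * Combination of the two perturbations *)

Theorem proposition4p6 (R : realType) (n p : nat) (M RIPW lamIPW : R)
  (D D' : dataset R n p) (lamhat lamhat' : 'cV[R]_p) (lmin : R)
  (hlamIPW : 0 <= lamIPW)
  (hneighbor : differ_at_one_point D D')
  (hM : forall i : 'I_n, norm2 (covariate D i) <= M)
  (hM' : forall i : 'I_n, norm2 (covariate D' i) <= M)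
  (hlamhat : is_ipw_estimator RIPW lamIPW D lamhat)
  (hlamhat' : is_ipw_estimator RIPW lamIPW D' lamhat')
  (hlmin : is_smallest_eigenvalue (sample_covariance D) lmin)
  (hlmin_gt0 : 0 < lmin) :
  let rho := expR (- (M * RIPW)) / (1 + expR (- (M * RIPW))) ^+ 2 * lmin
             + lamIPW in
  let deltaI := Num.min RIPW ((M / 2) / rho) in
  norm2 (ipw_weights D lamhat - ipw_weights D' lamhat')
  <= 4 * M ^+ 2 * expR (M * RIPW) / rho
     + 2 * M * deltaI * expR (M * deltaI)
       * (1 + (1 + expR (M * deltaI)) / (2 * n%:R)).
Proof.
cbv zeta; set rho := _ * lmin + _; set deltaI := Num.min _ _.
have n_gt0 : (0 < n)%N.
  by case: hneighbor => i0 _; apply: leq_ltn_trans (ltn_ord i0).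
have M0 : 0 <= M := le_trans (norm2_ge0 _) (hM (Ordinal n_gt0)).
have rho0 : 0 < rho by exact: strong_convexity_gt0.
have lamhat_le : norm2 lamhat <= deltaI.
  exact: norm2_ipw_estimator_le hlamIPW n_gt0 hM hlamhat hlmin hlmin_gt0.
have stab : norm2 (lamhat' - lamhat) <= 2 * M / n%:R / rho.
  exact: (ipw_estimator_stable hlamIPW n_gt0 hM hlamhat hlmin hlmin_gt0
            hneighbor hM').
rewrite -(subrKA (ipw_weights D' lamhat)).
apply: le_trans (norm2D _ _) _; rewrite addrC; apply: lerD; last first.
  exact: ipw_weights_change_one.
apply: le_trans (ipw_weights_change_parameter n_gt0 hM' (proj1 hlamhat)
  (proj1 hlamhat')) _.
have n1 : 1 <= n%:R :> R by rewrite ler1n.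
have sq0 : 0 <= Num.sqrt n%:R :> R by exact: sqrtr_ge0.
apply: (@le_trans _ _ (Num.sqrt n%:R
    * (2 * (M * (2 * M / n%:R / rho)) * expR (M * RIPW)))).
  by rewrite ler_wpM2l// ler_wpM2r ?expR_ge0// ler_wpM2l// ler_wpM2l.
(* The [1/n] from stability absorbs the [sqrt n] from passing from entries to the Euclidean norm, as
   [sqrt n / n <= 1]. *)
have -> : Num.sqrt n%:R * (2 * (M * (2 * M / n%:R / rho)) * expR (M * RIPW))
    = Num.sqrt n%:R / n%:R * (4 * M ^+ 2 * expR (M * RIPW) / rho).
  by field; lra.
rewrite ler_piMl ?divr_ge0 ?mulr_ge0 ?expR_ge0 ?exprn_ge0 ?(ltW rho0)//.
rewrite ler_pdivrMr ?mul1r; last by lra.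
rewrite -[leRHS]sqr_sqrtr// expr2 ler_peMr//.
by rewrite -[leLHS]sqrtr1 ler_wsqrtr.
Qed.
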